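(* Let $L\subset\mathbb{R}P^n$ be a projective subspace, $0\le \dim L\le n-1$, and let $A\subset\mathbb{R}P^n$ be an $L$-convex-concave set. Then: (1) the $L$-dual set $A^\bot_L\subset(\mathbb{R}P^n)^*$ is $L^*$-convex-concave; (2) $(A^\bot_L)^\bot_{L^*}=A$; (3) $A$ contains a projective subspace of dimension $n-1-\dim L$ if and only if $A^\bot_L$ contains a projective subspace of dimension $n-1-\dim L^*$. More precisely, if $A^\bot_L$ contains a projective subspace $M^*$ with $\dim M^*+\dim L^*=n-1$, then $A$ contains the dual subspace $M$ of $M^*$, and $\dim M+\dim L=n-1$.
   Context: Dual space: points of $(\mathbb{R}P^n)^*$ are the hyperplanes of $\mathbb{R}P^n$; for a projective subspace $L\subset\mathbb{R}P^n$, $L^*\subset(\mathbb{R}P^n)^*$ is the subspace of all hyperplanes containing $L$, of dimension $n-1-\dim L$; $((\mathbb{R}P^n)^* )^*$ is identified with $\mathbb{R}P^n$, so that $(L^* )^*=L$. The empty subspace has dimension $-1$. Projection: for a projective subspace $T\subset\mathbb{R}P^n$, $\mathbb{R}P^n/T$ is the projective space of dimension $n-\dim T-1$ whose points are the $(\dim T+1)$-dimensional subspaces containing $T$; the projection from the center $T$ sends $x\notin T$ to the span of $x$ and $T$. Convexity: a nonempty subset of a projective space is convex if it is disjoint from some hyperplane $H$ and is convex in the affine space obtained by removing $H$. A closed set $A\subset\mathbb{R}P^n$ is $L$-convex-concave if: 1) $A\cap L=\emptyset$; 2) for every $(\dim L+1)$-dimensional subspace $N\supset L$ the section $A\cap N$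 is convex; 3) for every $(\dim L-1)$-dimensional subspace $T\subset L$ the complement in $\mathbb{R}P^n/T$ of the projection of $A$ from the center $T$ is an open convex set. The same definition is used in $(\mathbb{R}P^n)^*$ with $L^*$ in place of $L$. $L$-dual set: for a set $A\subset\mathbb{R}P^n$ with $A\cap L=\emptyset$, $A^\bot_L\subset(\mathbb{R}P^n)^*$ is the set of all hyperplanes $\pi\not\supset L$ such that, with $L_\pi=L\cap\pi$, the image of $\pi$ in $\mathbb{R}P^n/L_\pi$ (a hyperplane there) is contained in the image of $A$. Equivalently, $\pi\in A^\bot_L$ iff $\pi\cap A\cap N\ne\emptyset$ for every $(\dim L+1)$-dimensional subspace $N\supset L$ and $\pi\not\supset L$. For $C\subset(\mathbb{R}P^n)^*$ disjoint from $L^*$, the set $C^\bot_{L^*}\subset\mathbb{R}P^n$ is defined in the same way. *)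

(* Defs.v *)
From HB Require Import structures.
From mathcomp Require Import all_boot all_order all_algebra.
From mathcomp Require Import all_classical all_reals all_analysis.

Set Implicit Arguments.
Unset Strict Implicit.
Unset Printing Implicit Defensive.

Import Order.TTheory GRing.Theory Num.Theory.
Import numFieldNormedType.Exports.

Local Open Scope classical_set_scope.
Local Open Scope ring_scope.

(* Real projective geometry in homogeneous coordinates.  A projective subspace
   of RP^n is a linear subspace of R^(n+1); the empty subspace, of projective
   dimension -1, is 0. *)

Definition pdim (R : realType) (n : nat) (U : {vspace 'rV[R]_n.+1}) : int :=
  (\dim U)%:Z - 1.

Lemma continuous_dot_num (K : numFieldType) (n : nat) (w : 'rV[K]_n.+1) :
  continuous (fun v : 'rV[K]_n.+1 => \sum_i v 0 i * w 0 i).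
Proof.
apply: continuous_big => [|i _ v]; first exact: add_continuous.
by apply: continuousM; [exact: coord_continuous | exact: cst_continuous].
Qed.

Section Duality.
Variables (R : realType) (n : nat).
Local Notation V := 'rV[R]_n.+1.
Implicit Types (U W : {vspace V}) (u v w : V).

Definition dot v w : R := \sum_i v 0 i * w 0 i.

Definition basis_pairing U : V -> 'rV[R]_(\dim U) :=
  fun v => \row_j dot v (vbasis U)`_j.

Lemma dotC v w : dot v w = dot w v.
Proof. by apply: eq_bigr => i _; rewrite mulrC. Qed.

Definition dotr w : V -> R^o := fun v => dot v w.

Lemma dotr_linear w : linear (dotr w).
Proof.
move=> a u v; rewrite /dotr /dot scaler_sumr -big_split /=; apply: eq_bigr => i _.
by rewrite !mxE mulrDl -mulrA.
Qed.

Lemma basis_pairing_linear U : linear (@basis_pairing U).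
Proof.
move=> a u v; apply/rowP => j; rewrite !mxE.
exact: (dotr_linear (vbasis U)`_j a u v).
Qed.

HB.instance Definition _ w :=
  GRing.isLinear.Build R V R^o _ (dotr w) (dotr_linear w).
HB.instance Definition _ U :=
  GRing.isLinear.Build R V 'rV[R]_(\dim U) _ (@basis_pairing U)
    (@basis_pairing_linear U).

(* The dual space (RP^n)^* is RP^n in dual coordinates: the point [a] of the
   dual is the hyperplane { x | dot x a = 0 }.  With this identification the
   dual subspace L^* is [perp L] (see [perp_hyperplaneE] below), and the
   identification of the double dual with RP^n is [perpK]. *)
Definition perp U : {vspace V} := lker (linfun (@basis_pairing U)).

Lemma mem_perpP U v :
  reflect (forall w, w \in U -> dot v w = 0) (v \in perp U).
Proof.
rewrite memv_ker lfunE /=; apply: (iffP eqP) => [v0 w wU | v0].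
  rewrite (coord_vbasis wU) dotC.
  rewrite -[LHS]/(dotr v _) linear_sum big1 //= => i _.
  rewrite [LHS]linearZ /= /dotr dotC.
  by move/rowP: v0 => /(_ i); rewrite !mxE => ->; rewrite scaler0.
by apply/rowP => j; rewrite !mxE v0 // vbasis_mem // mem_nth // size_tuple.
Qed.

Lemma sub_perpC U W : (U <= perp W)%VS = (W <= perp U)%VS.
Proof.
by apply/subvP/subvP => h v vU; apply/mem_perpP => w wW; rewrite dotC;
  have /mem_perpP := h _ wW; exact.
Qed.

Lemma capv_perp U : (U :&: perp U = 0)%VS.
Proof.
apply/eqP; rewrite -subv0; apply/subvP => v.
rewrite memv_cap memv0 => /andP[vU /mem_perpP /(_ v vU)] vv0.
apply/eqP/rowP => i; rewrite mxE; apply/eqP; rewrite -sqrf_eq0 expr2.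
move/eqP: vv0; rewrite /dot psumr_eq0 => [/allP /(_ i)|j _].
  by rewrite mem_index_enum => /(_ isT).
by rewrite -expr2 sqr_ge0.
Qed.

Lemma dim_perp U : (\dim U + \dim (perp U) = n.+1)%N.
Proof.
have dimV : \dim (fullv : {vspace V}) = n.+1 by rewrite dimvf /dim /= mul1n.
apply/eqP; rewrite eqn_leq; apply/andP; split.
  rewrite -(dimv_disjoint_sum (capv_perp U)).
  by apply: (leq_trans (dimvS (subvf _))); rewrite dimV.
apply: (leq_trans (eq_leq (esym dimV))).
rewrite -(limg_ker_dim (linfun (@basis_pairing U))).
rewrite capfv addnC leq_add2r (leq_trans (dimvS (subvf _))) //.
by rewrite dimvf /dim /= mul1n.
Qed.

Lemma perpK : involutive perp.
Proof.
move=> U; apply/esym/eqP; rewrite eqEdim sub_perpC subvv /=.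
by rewrite -(leq_add2l (\dim (perp U))) dim_perp addnC dim_perp.
Qed.

Lemma closed_vspace U : closed [set v : V | v \in U].
Proof.
rewrite (_ : [set _ | _] =
    \bigcap_(w in [set w | w \in perp U]) [set v | dot v w = 0]); last first.
  apply/seteqP; split => [v /= vU w /mem_perpP /(_ v vU) | v /= h].
    by rewrite dotC.
  by rewrite -(perpK U); apply/mem_perpP => w; exact: h.
apply: closed_bigI => w _.
apply: (@preimage_closed _ _ (fun v : V => dot v w) [set 0]) => [v _|].
  exact: continuous_dot_num.
exact: closed_eq.
Qed.

End Duality.

Section Quotient.
Variables (R : realType) (n : nat).
Local Notation V := 'rV[R]_n.+1.

(* [pspace T] is RP^n / T. *)
Record pspace (T : {vspace V}) := PSpace {
  pspace_val :> {vspace V};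
  pspaceP : (T <= pspace_val)%VS && (\dim pspace_val == (\dim T).+1) }.

HB.instance Definition _ T := [isSub for @pspace_val T].
HB.instance Definition _ T := [Choice of pspace T by <:].

Section Topology.
Variable T : {vspace V}.

Definition cone (S : set (pspace T)) : set V :=
  [set v | v \notin T /\ exists2 W : pspace T, S W & v \in pspace_val W].

(* The topology of RP^n / T is the quotient topology of V \ T. *)
Definition pspace_open (S : set (pspace T)) : Prop := open (cone S).

Lemma pspace_memE (v : V) (W : pspace T) :
  v \notin T -> v \in pspace_val W -> (T + <[v]>)%VS = W.
Proof.
move=> vT vW; have /andP[TW /eqP dW] := pspaceP W.
apply/eqP; rewrite eqEdim subv_add TW -memvE vW dW /=.
rewrite ltnNge; apply: contra vT => le.
have /eqP -> : (T == T + <[v]>)%VS by rewrite eqEdim addvSl.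
by rewrite memvE addvSr.
Qed.

Lemma pspace_span (v : V) : v \notin T ->
  (T <= T + <[v]>)%VS && (\dim (T + <[v]>) == (\dim T).+1).
Proof.
move=> vT; rewrite addvSl /= dimv_disjoint_sum.
  by rewrite dim_vline (_ : v != 0) ?addn1 //; apply: contraNneq vT => ->;
    rewrite mem0v.
apply/eqP; rewrite -subv0; apply/subvP => w.
rewrite memv_cap => /andP[wT /vlineP[k kw]]; rewrite memv0 kw.
have [-> | k0] := eqVneq k 0; first by rewrite scale0r.
by case/negP: vT; rewrite -[v](scalerK k0) -kw memvZ.
Qed.

Lemma pspace_openT : pspace_open setT.
Proof.
rewrite /pspace_open (_ : cone _ = ~` [set v | v \in T]).
  by apply: closed_openC; exact: closed_vspace.
apply/seteqP; split => v /=; first by case=> /negP.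
move=> /negP vT; split => //; exists (PSpace (pspace_span vT)) => //=.
by rewrite memvE addvSr.
Qed.

Lemma pspace_openI : setI_closed pspace_open.
Proof.
move=> A B oA oB; rewrite /pspace_open (_ : cone _ = cone A `&` cone B).
  exact: openI.
apply/seteqP; split => v /=.
  by case=> vT [W [AW BW] vW]; split; split => //; exists W.
case=> -[vT [W AW vW]] [_ [W' BW' vW']]; split => //; exists W => //.
split => //; rewrite (_ : W = W') //; apply: val_inj => /=.
by rewrite -(pspace_memE vT vW) -(pspace_memE vT vW').
Qed.

Lemma pspace_open_bigU (I : Type) (f : I -> set (pspace T)) :
  (forall i, pspace_open (f i)) -> pspace_open (\bigcup_i f i).
Proof.
move=> of_; rewrite /pspace_open (_ : cone _ = \bigcup_i cone (f i)).
  by apply: bigcup_open => i _; exact: of_.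
apply/seteqP; split => v /=.
  by case=> vT [W [i _ fW] vW]; exists i => //; split => //; exists W.
by case=> i _ [vT [W fW vW]]; split => //; exists W => //; exists i.
Qed.

HB.instance Definition _ := isOpenTopological.Build (pspace T)
  pspace_openT pspace_openI pspace_open_bigU.

(* The affine space RP^n / T minus a hyperplane H is modelled by the affine
   hyperplane u + H of V, for any u outside H, modulo translations by T. *)
Definition affine_trace (S : set (pspace T)) (H : {vspace V}) (u : V) :
    set V :=
  [set v | v - u \in H /\ exists2 W : pspace T, S W & v \in pspace_val W].

Definition projectively_convex (S : set (pspace T)) : Prop :=
  S !=set0 /\
  exists H : {vspace V}, [/\ (T <= H)%VS, \dim H = n,
    (forall W : pspace T, S W -> ~~ (pspace_val W <= H)%VS) &
    forall u : V, u \notin H -> convex_set (affine_trace S H u)].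

End Topology.

End Quotient.

Definition RP (R : realType) (n : nat) := pspace (0%VS : {vspace 'rV[R]_n.+1}).

(* The image of A under the projection from the center T; the points of A
   lying in T, where the projection is undefined, are ignored. *)
Definition proj_image (R : realType) (n : nat) (T : {vspace 'rV[R]_n.+1})
    (A : set (RP R n)) : set (pspace T) :=
  [set W : pspace T | exists2 x : RP R n, A x &
    ~~ (pspace_val x <= T)%VS /\
    (T + pspace_val x)%VS = pspace_val W].
Arguments proj_image {R n} T A _.

Section ConvexConcave.
Variables (R : realType) (n : nat).
Local Notation V := 'rV[R]_n.+1.
Implicit Types (A : set (RP R n)) (L N T U : {vspace V}).

Definition pts U : set (RP R n) :=
  [set x : RP R n | (pspace_val x <= U)%VS].

Definition convex_concave L A : Prop :=
  [/\ closed A, A `&` pts L = set0,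
    (forall N, (L <= N)%VS -> pdim N = pdim L + 1 ->
       projectively_convex (A `&` pts N)) &
    (forall T, (T <= L)%VS -> pdim T = pdim L - 1 ->
       open (~` proj_image T A) /\ projectively_convex (~` proj_image T A))].

(* The hyperplane of RP^n represented by the point q of the dual space. *)
Definition hyp (q : RP R n) : {vspace V} := perp q.

Definition Ldual L A : set (RP R n) :=
  [set q | ~~ (L <= hyp q)%VS /\
    proj_image (L :&: hyp q)%VS (pts (hyp q)) `<=`
    proj_image (L :&: hyp q)%VS A].

Lemma perp_hyperplaneE L (q : RP R n) : pts (perp L) q <-> (L <= hyp q)%VS.
Proof. by rewrite /pts /= sub_perpC. Qed.

Lemma dim_hyp (q : RP R n) : \dim (hyp q) = n.
Proof.
have /andP[_ /eqP dq] := pspaceP q.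
by have := dim_perp q; rewrite dq dimv0 add1n => -[].
Qed.

Lemma hyp_inj : injective hyp.
Proof. by move=> p q /(can_inj (@perpK R n)) /val_inj. Qed.

Lemma hyp_surj (H : {vspace V}) : \dim H = n -> exists q, hyp q = H.
Proof.
move=> dH; have dp : (0 <= perp H)%VS && (\dim (perp H) == (\dim (0%VS : {vspace V})).+1).
  rewrite sub0v dimv0 /= -(eqn_add2l (\dim H)) dim_perp dH addn1 //.
by exists (PSpace dp); rewrite /hyp /= perpK.
Qed.

End ConvexConcave.

(* Main.v *)
Require Import Defs.
From HB Require Import structures.
From mathcomp Require Import all_boot all_order all_algebra.
From mathcomp Require Import all_classical all_reals all_analysis.
From mathcomp Require Import zify lra ring.

Set Implicit Arguments.
Unset Strict Implicit.
Unset Printing Implicit Defensive.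

Import Order.TTheory GRing.Theory Num.Theory.
Import numFieldNormedType.Exports.

Local Open Scope classical_set_scope.
Local Open Scope ring_scope.

(** Decompose R^(n+1) as L + K with K = perp L. The section of the cone C over
    A by the affine subspace x + L is a compact convex set; let h(q, x) be the
    maximum of q on it. As a support function h is sublinear in q; convexity
    of the complements of the projections makes it sublinear in x: the trace
    of such a complement on an affine hyperplane is a sublevel set of h(q, .)
    plus a linear form. A hyperplane q belongs to the L-dual set iff it meets
    every section, i.e. iff -q restricted to K is a linear form dominated by
    h(q, .). Hence the sections of the dual cone are the subdifferentials of
    h(q, .), so duality exchanges the two arguments of h up to sign. Hahn-
    Banach then gives the convex-concavity of the dual, and separation of a
    point from a compact convex section gives biduality. *)

(** * The pairing [dot] and orthogonal complements *)

Section Dot.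
Context {R : realType} {n : nat}.
Local Notation V := 'rV[R]_n.+1.
Implicit Types (U L : {vspace V}) (u v w : V).

Lemma dotDl u v w : dot (u + v) w = dot u w + dot v w.
Proof. exact: (linearD (dotr w)). Qed.

Lemma dotZl a u w : dot (a *: u) w = a * dot u w.
Proof. by rewrite /dot mulr_sumr; apply: eq_bigr => i _; rewrite mxE mulrA. Qed.

Lemma dotNl u w : dot (- u) w = - dot u w.
Proof. by rewrite -scaleN1r dotZl mulN1r. Qed.

Lemma dotDr u v w : dot u (v + w) = dot u v + dot u w.
Proof. by rewrite ![dot u _]dotC dotDl. Qed.

Lemma dotZr a u w : dot u (a *: w) = a * dot u w.
Proof. by rewrite ![dot u _]dotC dotZl. Qed.

Lemma dotNr u w : dot u (- w) = - dot u w.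
Proof. by rewrite ![dot u _]dotC dotNl. Qed.

Definition dotE := (dotDl, dotDr, dotZl, dotZr, dotNl, dotNr).

Lemma dot0l w : dot 0 w = 0.
Proof. by rewrite -[0](scale0r w) dotZl mul0r. Qed.

Lemma dot0r w : dot w 0 = 0.
Proof. by rewrite dotC dot0l. Qed.

Lemma dot_ge0 v : 0 <= dot v v.
Proof. by apply: sumr_ge0 => i _; rewrite -expr2 sqr_ge0. Qed.

Lemma dot_eq0 v : (dot v v == 0) = (v == 0).
Proof.
apply/eqP/eqP => [|->]; last exact: dot0l.
move/eqP; rewrite psumr_eq0 => [/allP vv|i _]; last by rewrite -expr2 sqr_ge0.
apply/rowP => i; rewrite mxE; apply/eqP; rewrite -sqrf_eq0 expr2.
exact: vv (mem_index_enum i).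
Qed.

Lemma dot_gt0 v : (0 < dot v v) = (v != 0).
Proof. by rewrite lt_def dot_eq0 dot_ge0 andbT. Qed.

Lemma dot_perp {U u v} : u \in U -> v \in perp U -> dot u v = 0.
Proof. by move=> uU /mem_perpP/(_ u uU); rewrite dotC. Qed.

Lemma notin_perp U v : v \notin perp U -> exists2 w, w \in U & dot w v != 0.
Proof.
move=> vU; apply: contrapT => nex; move/negP: vU; apply.
apply/mem_perpP => w wU; rewrite dotC; apply/eqP.
by apply/negPn/negP => ?; apply: nex; exists w.
Qed.

Lemma addv_perp U : (U + perp U = fullv)%VS.
Proof.
apply/eqP; rewrite eqEdim subvf /= dimv_disjoint_sum ?capv_perp // dim_perp.
by rewrite dimvf /dim /= mul1n.
Qed.

Lemma perp_split U v : exists u w, [/\ u \in U, w \in perp U & v = u + w].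
Proof.
have : v \in fullv by rewrite memvf.
by rewrite -(addv_perp U) => /memv_addP[u uU [w wU ->]]; exists u, w.
Qed.

Lemma continuous_dot : continuous (fun p : V * V => dot p.1 p.2).
Proof.
apply: continuous_big => [|i _ p]; first exact: add_continuous.
apply: continuousM; apply: (@continuous_comp _ _ _ _ (fun v : V => v 0 i)).
- exact: cvg_fst.
- exact: coord_continuous.
- exact: cvg_snd.
- exact: coord_continuous.
Qed.

End Dot.

(** * Hahn-Banach for forms dominated by a sublinear function *)

Section HahnBanach.
Context {R : realType} {n : nat}.
Local Notation V := 'rV[R]_n.+1.
Implicit Types (U : {vspace V}) (u v w x : V).
Context (s : V -> R).
Hypothesis sD : forall x y : V, s (x + y) <= s x + s y.
Hypothesis sZ : forall (a : R) (x : V), 0 <= a -> s (a *: x) = a * s x.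

(** By subadditivity every lower bound [dot w u - s (u - v)] for the value at [v] is below every
    upper bound [s (x + v) - dot w x]; the supremum of the lower bounds is thus admissible. *)
Lemma dominated_extend1 U w v : v \notin U ->
  (forall u, u \in U -> dot w u <= s u) ->
  exists w', (forall u, u \in U -> dot w' u = dot w u) /\
    forall u, u \in (U + <[v]>)%VS -> dot w' u <= s u.
Proof.
move=> vU ws.
(* Adding a multiple of [z] keeps the form on [U] and prescribes its value at [v]. *)
have [z zU zv] : exists2 z, z \in perp U & dot z v != 0.
  by apply: notin_perp; rewrite perpK.
pose E := [set dot w u - s (u - v) | u in [set u : V | u \in U]].
have ubE x : x \in U -> ubound E (s (x + v) - dot w x).
  move=> xU _ [u uU <-]; have := ws _ (memvD uU xU); rewrite dotDr.
  by have := sD (u - v) (x + v); rewrite addrACA addNr addr0; lra.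
have hE : has_sup E.
  split; first by exists (dot w 0 - s (0 - v)), 0 => //=; exact: mem0v.
  by exists (s (0 + v) - dot w 0); apply: ubE; exact: mem0v.
pose c := sup E.
have cge u : u \in U -> dot w u - s (u - v) <= c.
  by move=> uU; apply: sup_upper_bound => //; exists u.
have cle u : u \in U -> c <= s (u + v) - dot w u.
  by move=> uU; apply: ge_sup (ubE _ uU); case: hE.
have w'U u : u \in U -> dot (w + ((c - dot w v) / dot z v) *: z) u = dot w u.
  by move=> uU; rewrite dotDl dotZl [dot z u]dotC (dot_perp uU zU) mulr0 addr0.
exists (w + ((c - dot w v) / dot z v) *: z); split => // _
  /memv_addP[u uU [_ /vlineP[t ->] ->]].
rewrite dotDr w'U // dotZr dotDl dotZl divfK // [dot w v + _]addrC subrK.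
case: (ltgtP t 0) => [t0|t0|->].
- have nt : 0 < - t by rewrite oppr_gt0.
  have := cge ((- t)^-1 *: u) (memvZ _ uU).
  have -> : u + t *: v = (- t) *: ((- t)^-1 *: u - v).
    by rewrite scalerBr scalerA divff ?oppr_eq0 ?lt_eqF // scale1r scaleNr
      opprK.
  rewrite (sZ _ (ltW nt)) dotZr -(ler_pM2l nt) mulrBr mulrA divff ?gt_eqF //.
  by lra.
- have := cle (t^-1 *: u) (memvZ _ uU).
  have -> : u + t *: v = t *: (t^-1 *: u + v).
    by rewrite scalerDr scalerA divff ?gt_eqF // scale1r.
  rewrite (sZ _ (ltW t0)) dotZr -(ler_pM2l t0) mulrBr mulrA divff ?gt_eqF //.
  by lra.
- by rewrite scale0r mul0r !addr0 ws.
Qed.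

Lemma dominated_extend U w : (forall u, u \in U -> dot w u <= s u) ->
  exists g, (forall u, u \in U -> dot g u = dot w u) /\
    forall x, dot g x <= s x.
Proof.
have [k] := ubnP (n.+1 - \dim U)%N; elim: k U w => // k IH U w kU ws.
have dimV : \dim (fullv : {vspace V}) = n.+1 by rewrite dimvf /dim /= mul1n.
case: (boolP (U == fullv)) => [/eqP Uf|UNf].
  by exists w; split => // x; apply: ws; rewrite Uf memvf.
have [v vU] : exists v, v \notin U.
  apply: contrapT => nex; move/negP: UNf; apply; rewrite eqEsubv subvf /=.
  by apply/subvP => v _; apply/negPn/negP => vU; apply: nex; exists v.
have [w' [w'U w's]] := dominated_extend1 vU ws.
have /andP[_ /eqP dUv] := pspace_span vU.
have dle : (\dim (U + <[v]>) <= n.+1)%N.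
  by apply: leq_trans (dimvS (subvf _)) _; rewrite dimV.
have [|g [gU gs]] := IH _ w' _ w's.
  by move: kU dle; rewrite dUv; case: (\dim U) => [|m]; lia.
exists g; split => // u uU; rewrite gU ?w'U //.
by rewrite -[u]addr0 memv_add // mem0v.
Qed.

Lemma hahn_banach x0 : exists2 g, forall x, dot g x <= s x & dot g x0 = s x0.
Proof.
have s0 : s 0 = 0 by rewrite -[0](scale0r (0 : V)) sZ // mul0r.
pose w := (s x0 / dot x0 x0) *: x0.
have wx0 : dot w x0 = s x0.
  rewrite dotZl; have [->|x00] := eqVneq x0 0; first by rewrite s0 dot0l mulr0.
  by rewrite divfK // dot_eq0.
have [|g [gU gs]] := @dominated_extend <[x0]>%VS w.
  move=> _ /vlineP[t ->]; rewrite dotZr wx0.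
  have [t0|t0] := leP 0 t; first by rewrite sZ.
  have := sD (t *: x0) ((- t) *: x0); rewrite -scalerDl subrr scale0r s0.
  by rewrite (@sZ (- t)) ?oppr_ge0 ?(ltW t0) //; lra.
by exists g => //; rewrite gU ?memv_line.
Qed.

End HahnBanach.

(** The tube lemma, source of the norm bound on cones, of closedness of the dual and of openness of
    complements of projections. *)
Lemma compact_tube (X Y : topologicalType) (K : set Y) (O : set (X * Y))
    (z : X) :
  compact K -> open O -> (forall y, K y -> O (z, y)) ->
  \forall x \near z, K `<=` [set y | O (x, y)].
Proof.
move=> /compact_near_coveringP cK oO KO.
apply: cK => y /KO zyO.
have : nbhs (z, y) O by exact: open_nbhs_nbhs.
case=> -[P Q] /= [Pz Qy] PQO; exists (Q, P) => //= -[y' z'] /= [Qy' Pz'].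
exact: (PQO (z', y')).
Qed.

(** * Cones with compact convex sections *)

Section ConvexConcaveCone.
Context {R : realType} {n : nat}.
Local Notation V := 'rV[R]_n.+1.
Implicit Types (L : {vspace V}) (C : set V) (q c d v x y : V).

(** An affine chart, for [x] outside [L], of the section by [L + <[x]>]. *)
Definition fiber L C x : set V := [set c | C c /\ c - x \in L].

Record section_convex_cone L C : Prop := SectionConvexCone {
  cc_closed : closed C;
  cc_scale : forall (a : R) v, C v -> C (a *: v);
  cc_disj : forall v, C v -> v \in L -> v = 0;
  cc_inhab : forall x, fiber L C x !=set0;
  cc_conv : forall (t : R) c d, C c -> C d -> c - d \in L -> 0 <= t <= 1 ->
    C (t *: c + (1 - t) *: d) }.

(* [cc_sub] is condition 3 of convex-concavity: the support function of the
   sections, [x |-> max (dot q c)] over [c] in [fiber L C x], is subadditive. *)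
Record ccone L C : Prop := CCone {
  cc_sections :> section_convex_cone L C;
  cc_sub : forall q c x y, fiber L C (x + y) c ->
    exists c1 c2, [/\ fiber L C x c1, fiber L C y c2 &
      dot q c <= dot q c1 + dot q c2] }.

(** Forms whose kernel meets every section; [coneset_Ldual] identifies this with the cone over the
    [L]-dual set. *)
Definition dual_cone L C : set V :=
  [set q | forall x, exists2 c, fiber L C x c & dot q c = 0].

Section Cone.
Context (L : {vspace V}) (C : set V) (hC : section_convex_cone L C).

(** The unit vectors of [C] form a compact set disjoint from [L], hence, by the tube lemma, from
    [z + L] for all [z] of norm below some [e]; rescaling gives the constant [e^-1]. *)
Lemma cone_bound : exists2 M : R, 0 < M &
  forall c z, C c -> c - z \in L -> `|c| <= M * `|z|.
Proof.
pose S := C `&` [set v : V | `|v| = 1].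
have cS : compact S.
  apply: bounded_closed_compact.
    exists 1; split; first exact: real1.
    by move=> x x1 v [_ /= ->]; exact: ltW.
  apply: closedI; first exact: cc_closed hC.
  apply: (@preimage_closed _ _ (fun v : V => `|v|) [set (1 : R)]) => [v _|].
    exact: norm_continuous.
  exact: closed_eq.
pose O := [set p : V * V | p.2 - p.1 \notin L].
have oO : open O.
  rewrite (_ : O = (fun p : V * V => p.2 - p.1) @^-1` (~` [set v | v \in L])).
    apply: open_comp; last by apply: closed_openC; exact: closed_vspace.
    move=> p _; apply: (@continuousB _ V).
      exact: cvg_snd.
    exact: cvg_fst.
  by apply/seteqP; split => p /= /negP.
have SO v : S v -> O (0, v).
  move=> [Cv v1]; rewrite /O /= subr0; apply/negP => vL.
  move: v1; rewrite (cc_disj hC Cv vL) /= normr0 => /esym/eqP.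
  by rewrite oner_eq0.
have /nbhs_normP[e /= e0 he] := compact_tube cS oO SO.
exists e^-1; first by rewrite invr_gt0.
move=> c z Cc czL; rewrite leNgt; apply/negP => lt.
have c0 : 0 < `|c|.
  by apply: le_lt_trans lt; apply: mulr_ge0 => //; rewrite invr_ge0 ltW.
have Sc : S (`|c|^-1 *: c).
  split; first exact: cc_scale hC _ _ Cc.
  by rewrite /= normrZ ger0_norm ?invr_ge0 // mulVf // gt_eqF.
have /= := he (`|c|^-1 *: z).
rewrite sub0r normrN normrZ ger0_norm ?invr_ge0 // mulrC.
rewrite ltr_pdivrMr // -ltr_pdivrMl // => /(_ lt _ Sc) /=.
by rewrite /O /= -scalerBr memvZ.
Qed.

Lemma fiber_compact x : compact (fiber L C x).
Proof.
apply: bounded_closed_compact.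
  have [M M0 hM] := cone_bound.
  exists (M * `|x|); split; first by rewrite num_real.
  by move=> y xy c [Cc cx]; apply: le_trans (hM _ _ Cc cx) (ltW xy).
apply: closedI; first exact: cc_closed hC.
apply: (@preimage_closed _ _ (fun v : V => v - x) [set v | v \in L]) => [v _|].
  apply: (@continuousB _ V); [exact: cvg_id | exact: cst_continuous].
exact: closed_vspace.
Qed.

Lemma fiber_max q x : exists2 c, fiber L C x c &
  forall d, fiber L C x d -> dot q d <= dot q c.
Proof.
have [c /set_mem Fc maxc] : exists2 c, c \in fiber L C x &
    forall d, d \in fiber L C x -> dot q d <= dot q c.
  apply: EVT_max_rV; [exact: cc_inhab hC x | exact: fiber_compact |].
  apply: continuous_subspaceT.
  rewrite (_ : dot q = fun v : V => \sum_i v 0 i * q 0 i).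
    exact: continuous_dot_num.
  by apply/funext => v; rewrite dotC.
by exists c => // d Fd; apply: maxc; exact: mem_set.
Qed.

Lemma fiber_conv x (t : R) c d : fiber L C x c -> fiber L C x d ->
  0 <= t <= 1 -> fiber L C x (t *: c + (1 - t) *: d).
Proof.
move=> [Cc cx] [Cd dx] t01; split.
  apply: cc_conv hC _ _ _ Cc Cd _ t01.
  have -> : c - d = (c - x) - (d - x) by rewrite opprB addrA subrK.
  exact: memvB.
have -> : t *: c + (1 - t) *: d - x = t *: (c - x) + (1 - t) *: (d - x).
  by rewrite !scalerBr addrACA -opprD -scalerDl [t + _]addrC subrK scale1r.
by rewrite memvD ?memvZ.
Qed.

Lemma fiberZ (a : R) x c : fiber L C x c -> fiber L C (a *: x) (a *: c).
Proof.
by case=> Cc cx; split; [exact: cc_scale hC _ _ Cc | rewrite -scalerBr memvZ].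
Qed.

Lemma fiberN x c : fiber L C x c -> fiber L C (- x) (- c).
Proof. by rewrite -[- x]scaleN1r -[- c]scaleN1r; exact: fiberZ. Qed.

(** Sections are convex, so a form takes all intermediate values; a change of sign thus yields the
    zero asked for by [dual_cone]. *)
Lemma fiber_ivt q x (a : R) c d : fiber L C x c -> fiber L C x d ->
  dot q c <= a <= dot q d -> exists2 e, fiber L C x e & dot q e = a.
Proof.
move=> Fc Fd /andP[ca ad].
have [eq|lt] := eqVneq (dot q c) (dot q d).
  by exists c => //; apply/eqP; rewrite eq_le ca eq.
pose t := (a - dot q c) / (dot q d - dot q c).
have h : 0 < dot q d - dot q c.
  by rewrite subr_gt0 lt_neqAle lt (le_trans ca ad).
exists (t *: d + (1 - t) *: c).
  apply: fiber_conv => //; rewrite /t divr_ge0 ?ler_pdivrMr ?mul1r //.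
  - by lra.
  - by lra.
  - by lra.
by rewrite !dotE /t; field; rewrite gt_eqF.
Qed.

End Cone.
End ConvexConcaveCone.

(** * The dual cone and biduality *)

Section DualCone.
Context {R : realType} {n : nat}.
Local Notation V := 'rV[R]_n.+1.
Implicit Types (q c d v x y p b : V).
Context (L : {vspace V}) (C : set V) (hC : ccone L C).
Local Notation K := (perp L).
Local Notation B := (dual_cone L C).

Lemma dot_fiber g x c : g \in K -> fiber L C x c -> dot g c = dot g x.
Proof.
move=> gK [_ cx]; apply/eqP; rewrite -subr_eq0 -dotNr -dotDr dotC.
by rewrite (dot_perp cx gK).
Qed.

(* [b] is [q - g], where [g] is a linear functional dominated by the support
   function of the fibres in the direction [q] and equal to it at [x]. *)
Lemma dual_fiber_support q x : exists2 b, fiber K B q b &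
  forall c, fiber L C x c -> dot b c <= 0.
Proof.
have /choice[m hm] : forall y, exists c, fiber L C y c /\
    forall d, fiber L C y d -> dot q d <= dot q c.
  by move=> y; have [c Fc maxc] := fiber_max hC q y; exists c.
have Fm y : fiber L C y (m y) by case: (hm y).
have maxm y d : fiber L C y d -> dot q d <= dot q (m y).
  by case: (hm y) => _; exact.
pose s y := dot q (m y).
have mL l : l \in L -> m l = 0.
  move=> lL; have [Cm ml] := Fm l; apply: (cc_disj hC Cm).
  by rewrite -(subrK l (m l)) memvD.
have sD (y z : V) : s (y + z) <= s y + s z.
  have [c1 [c2 [F1 F2 le12]]] := cc_sub hC q (Fm (y + z)).
  by apply: (le_trans le12); rewrite lerD // maxm.
have sZ (a : R) y : 0 <= a -> s (a *: y) = a * s y.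
  rewrite le_eqVlt => /predU1P[<-|a0].
    by rewrite scale0r mul0r /s mL ?mem0v // dot0r.
  apply/eqP; rewrite eq_le /s; apply/andP; split; last first.
    by rewrite -dotZr; apply: maxm; exact: (fiberZ hC).
  rewrite -ler_pdivrMl // -dotZr; apply: maxm.
  have an0 : a != 0 by rewrite gt_eqF.
  by rewrite -[X in fiber _ _ X](scalerK an0); exact: (fiberZ hC).
have [g gs gx] := hahn_banach sD sZ x.
have gK : g \in K.
  apply/mem_perpP => l lL; apply/eqP; rewrite eq_le.
  have := gs l; have := gs (- l); rewrite /s !mL ?memvN // dotNr dot0r.
  by rewrite oppr_le0 => -> ->.
have bE y c : fiber L C y c -> dot (q - g) c = dot q c - dot g y.
  by move=> Fc; rewrite dotDl dotNl (dot_fiber gK Fc).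
exists (q - g).
  split; last by rewrite addrAC subrr add0r memvN.
  (* [- m (- y)] minimises [dot q] over the section at [y]. Domination at [y] and [- y] makes
     [q - g] nonnegative at the maximiser and nonpositive at the minimiser. *)
  move=> y; have Fn : fiber L C y (- m (- y)).
    by rewrite -{1}(opprK y); exact: (fiberN hC).
  apply: (fiber_ivt hC Fn (Fm y)); rewrite !(bE y) // dotNr.
  have := gs y; have := gs (- y); rewrite dotNr /s; lra.
by move=> c Fc; rewrite (bE _ _ Fc) gx subr_le0 maxm.
Qed.

(** Compact sections give closedness through the tube lemma; Hahn-Banach gives nonempty sections
    and, through supports at [- v], subadditivity. *)
Lemma ccone_dual_cone : ccone K B.
Proof.
split; first split.
- rewrite (_ : B = \bigcap_x [set q | exists2 c, fiber L C x c & dot q c = 0]).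
    apply: closed_bigI => x _; rewrite -openC.
    pose O := [set p : V * V | dot p.1 p.2 != 0].
    have oO : open O.
      rewrite (_ : O = (fun p : V * V => dot p.1 p.2) @^-1` (~` [set (0 : R)])).
        apply: open_comp; first by move=> p _; exact: continuous_dot.
        by apply: closed_openC; exact: closed_eq.
      by apply/seteqP; split => p /= /eqP.
    rewrite openE => q qn; have := @compact_tube _ _ _ _ q
      (fiber_compact hC (x := x)) oO.
    move=> /(_ _)[|r /= r0 hr].
      by move=> c Fc; apply/negP => /eqP qc; apply: qn; exists c.
    exists r => // q' /hr {}hr [c Fc /eqP q'c].
    by have /negP := hr c Fc.
  by apply/seteqP; split => q; [move=> Bq x _; exact: Bq|move=> h x; exact: h].
- move=> a q Bq x; have [c Fc qc] := Bq x.
  by exists c => //; rewrite dotZl qc mulr0.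
(* In the section over [q] itself, a form of [perp L] is constant, so [dot q c = dot q q]. *)
- move=> q Bq qK; have [c Fc] := Bq q; rewrite (dot_fiber qK Fc) => /eqP.
  by rewrite dot_eq0 => /eqP.
- by move=> q; have [b Fb _] := dual_fiber_support q 0; exists b.
- move=> t b d Bb Bd bd t01 x.
  have [c Fc bc] := Bb x; have [c' Fc' dc'] := Bd x.
  (* The cross terms [dot b c'] and [dot d c] cancel, as [b - d] is constant on the section. *)
  exists (t *: c + (1 - t) *: c'); first exact: (fiber_conv hC).
  have e1 := dot_fiber bd Fc; have := dot_fiber bd Fc'; rewrite -e1.
  by rewrite !dotE bc dc' => e; nra.
move=> v b p1 p2 [Bb bp].
have [b1 F1 le1] := dual_fiber_support p1 (- v).
have [b2 F2 le2] := dual_fiber_support p2 (- v).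
exists b1, b2; split => //.
(* As [c + v] is in [L] and [b - b1 - b2] in [perp L], [dot v (b - b1 - b2)] equals
   [dot c b1 + dot c b2], which is at most 0. *)
have [c Fc bc] := Bb (- v).
have vcL : c + v \in L by case: Fc => _; rewrite opprK.
have e := dot_perp vcL bp; have e1 := dot_perp vcL (proj2 F1).
have e2 := dot_perp vcL (proj2 F2); have := le1 _ Fc; have := le2 _ Fc.
move: e e1 e2; rewrite [dot b1 c]dotC [dot b2 c]dotC.
move: bc; rewrite dotC !dotE; lra.
Qed.

(** The supports at [v] and at [- v] have opposite weak signs at [v]; an intermediate dual element
    vanishes there. *)
Lemma sub_dual_coneK : C `<=` dual_cone K B.
Proof.
move=> v Cv p.
have Fv : fiber L C v v by split; rewrite ?subrr ?mem0v.
have [b Fb le1] := dual_fiber_support p v.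
have [b' Fb' le2] := dual_fiber_support p (- v).
apply: (fiber_ivt ccone_dual_cone Fb Fb').
rewrite ![dot v _]dotC le1 // -oppr_le0 -dotNr le2 //; exact: (fiberN hC).
Qed.

(** The form is [v - c], with [c] the point of the section nearest to [v] for the Euclidean distance
    of [dot]. *)
Lemma fiber_separation v : ~ C v ->
  exists p, forall c, fiber L C v c -> dot p c < dot p v.
Proof.
move=> Cv.
have [c [Fc minc]] : exists c, fiber L C v c /\
    forall d, fiber L C v d -> dot (v - c) (v - c) <= dot (v - d) (v - d).
  have [c /set_mem Fc minc] : exists2 c, c \in fiber L C v &
    forall d, d \in fiber L C v -> dot (v - c) (v - c) <= dot (v - d) (v - d).
    apply: (@EVT_min_rV _ _ (fun c => dot (v - c) (v - c))).
    - exact: cc_inhab hC v.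
    - exact: (fiber_compact hC).
    apply: continuous_subspaceT => c.
    have cg : {for c, continuous (fun c : V => v - c)}.
      by apply: (@continuousB _ V); [exact: cst_continuous | exact: cvg_id].
    apply: (@continuous_comp _ _ _ (fun c : V => (v - c, v - c))
              (fun p : V * V => dot p.1 p.2)); last exact: continuous_dot.
    exact: (cvg_pair cg cg).
  by exists c; split => // d Fd; apply: minc; exact: mem_set.
have vc : 0 < dot (v - c) (v - c).
  rewrite dot_gt0 subr_eq0; apply/eqP => e; apply: Cv; rewrite e.
  by case: Fc.
exists (v - c) => d Fd; rewrite -subr_gt0 -dotNr -dotDr.
have -> : v - d = (v - c) + (c - d) by rewrite addrA subrK.
rewrite dotDr; set a := dot _ (v - c) in vc *; set e := dot _ (c - d).
suff : 0 <= e by lra.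
rewrite leNgt; apply/negP => e0.
pose f := dot (c - d) (c - d).
have f0 : 0 <= f by exact: dot_ge0.
(* A short enough step from [c] towards [d] would approach [v]. *)
pose t := - e / (f - e).
have fe : 0 < f - e by lra.
have te : t * (f - e) = - e by rewrite /t divfK // gt_eqF.
have t0 : 0 < t by rewrite divr_gt0 // oppr_gt0.
have t1 : t <= 1 by rewrite ler_pdivrMr // mul1r; lra.
have := minc _ (fiber_conv hC Fd Fc (_ : 0 <= t <= 1)).
rewrite t1 ltW // => /(_ isT).
have -> : v - (t *: d + (1 - t) *: c) = (v - c) + t *: (c - d).
  by apply/rowP => i; rewrite !mxE; ring.
have sq (u w : V) : dot (u + t *: w) (u + t *: w) =
    dot u u + t * (2 * dot u w + t * dot w w).
  by rewrite !dotE [dot w u]dotC; ring.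
rewrite sq -/a -/e -/f lerDl pmulr_rge0 //.
by nra.
Qed.

(** If [p] separates [v] from its section, some [b] over [p] vanishes at [v] and at a point [c] of
    that section. Since [v - c] is in [L] and [b - p] in [perp L], [dot p v = dot p c], a
    contradiction. *)
Lemma dual_coneK : dual_cone K B = C.
Proof.
apply/seteqP; split; last exact: sub_dual_coneK.
move=> v BBv; apply: contrapT => /fiber_separation[p hp].
have [b [Bb bp] vb] := BBv p; have [c Fc bc] := Bb v.
have := hp _ Fc; rewrite -subr_gt0 -dotNr -dotDr.
have vcL : v - c \in L by rewrite -memvN opprB; case: Fc.
have := dot_perp vcL bp; rewrite dotDr dotNr.
rewrite [dot (v - c) b]dotC [dot b (v - c)]dotDr [dot b v]dotC vb dotNr bc.
by rewrite [dot (v - c) p]dotC; lra.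
Qed.

End DualCone.

(** * Dictionary between projective sets and their cones *)

Section Projective.
Context {R : realType} {n : nat}.
Local Notation V := 'rV[R]_n.+1.
Implicit Types (L T N H U : {vspace V}) (A S : set (RP R n)) (v w x p h : V).

Lemma convex_setP (S : set V) : convex_set S <->
  forall (t : R) x y, S x -> S y -> 0 <= t <= 1 -> S (t *: x + (1 - t) *: y).
Proof.
split=> [cS t x y Sx Sy /andP[t0 t1]|cS x y t /set_mem Sx /set_mem Sy].
  exact/set_mem/(cS x y (Itv01 t0 t1) (mem_set Sx) (mem_set Sy)).
by apply/mem_set; apply: (cS t%:num x y Sx Sy); rewrite ge0 le1.
Qed.

Lemma vline_point v : v != 0 -> exists W : RP R n, pspace_val W = <[v]>%VS.
Proof.
rewrite -memv0 => v0; exists (PSpace (pspace_span v0)) => /=.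
by rewrite add0v.
Qed.

Lemma RP_vline (W : RP R n) v : v != 0 -> v \in pspace_val W ->
  pspace_val W = <[v]>%VS.
Proof.
move=> v0 vW; rewrite -(@pspace_memE _ _ _ v W _ vW) ?add0v //.
by rewrite memv0.
Qed.

Lemma RP_gen (W : RP R n) : exists2 v, v != 0 & pspace_val W = <[v]>%VS.
Proof.
have /andP[_ /eqP dW] := pspaceP W.
exists (vpick (pspace_val W)).
  by rewrite vpick0 -dimv_eq0 dW dimv0.
apply: RP_vline; last exact: memv_pick.
by rewrite vpick0 -dimv_eq0 dW dimv0.
Qed.

(** The origin is adjoined so that the cone is closed exactly when [A] is. *)
Definition coneset A : set V :=
  [set v | v = 0 \/ exists2 W : RP R n, A W & v \in pspace_val W].

Lemma coneset_mem A W v : v != 0 -> v \in pspace_val W -> coneset A v <-> A W.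
Proof.
move=> v0 vW; split=> [[/eqP|[W' AW' vW']]|AW]; first by rewrite (negPf v0).
  rewrite (_ : W = W') //; apply: val_inj.
  by rewrite /= (RP_vline v0 vW) (RP_vline v0 vW').
by right; exists W.
Qed.

Lemma coneset_neq0 A v : v != 0 -> coneset A v ->
  exists2 W : RP R n, A W & pspace_val W = <[v]>%VS.
Proof.
move=> v0 [/eqP|[W AW vW]]; first by rewrite (negPf v0).
by exists W => //; exact: RP_vline.
Qed.

Lemma coneset_inj : injective coneset.
Proof.
move=> A B AB; apply/seteqP; split => W; have [v v0 Wv] := RP_gen W;
  have vW : v \in pspace_val W by rewrite Wv memv_line.
  by move=> /(coneset_mem A v0 vW); rewrite AB => /(coneset_mem B v0 vW).
by move=> /(coneset_mem B v0 vW); rewrite -AB => /(coneset_mem A v0 vW).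
Qed.

Lemma coneset_pts U v : coneset (pts U) v <-> v \in U.
Proof.
split=> [[->|[W WU]]|vU]; first exact: mem0v.
  by move: v; apply/subvP.
have [->|v0] := eqVneq v 0; first by left.
have [W Wv] := vline_point v0.
by right; exists W; rewrite ?Wv ?memv_line // /pts /= Wv -memvE.
Qed.

Lemma cone_setC A : cone (~` A) = ~` coneset A.
Proof.
apply/seteqP; split => v.
  case; rewrite memv0 => v0 [W nAW vW] Cv; apply: nAW.
  exact/(coneset_mem A v0 vW).
move=> nCv; have v0 : v != 0 by apply/eqP => v0; apply: nCv; left.
have [W Wv] := vline_point v0; split; first by rewrite memv0.
by exists W; rewrite ?Wv ?memv_line // => AW; apply: nCv; right; exists W;
  rewrite ?Wv ?memv_line.
Qed.

Lemma closed_coneset A : closed A <-> closed (coneset A).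
Proof. by rewrite -!openC -cone_setC. Qed.

Lemma pspace_notsub T (W : pspace T) :
  exists2 v, v \in pspace_val W & v \notin T.
Proof.
have /andP[TW /eqP dW] := pspaceP W.
apply: contrapT => nex; have : (pspace_val W <= T)%VS.
  by apply/subvP => v vW; apply/negPn/negP => vT; apply: nex; exists v.
by move/dimvS; rewrite dW ltnn.
Qed.

Lemma proj_imageP T A (W : pspace T) v : v \notin T -> v \in pspace_val W ->
  proj_image T A W <-> exists2 c, coneset A c & v - c \in T.
Proof.
move=> vT vW; have /andP[TW _] := pspaceP W.
split=> [[X AX [XT TXW]]|[c Cc vcT]].
  move: vW; rewrite -TXW => /memv_addP[t tT [c cX ->]].
  by exists c; [right; exists X | rewrite addrK].
have cT : c \notin T by apply: contra vT => cT; rewrite -(subrK c v) memvD.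
have c0 : c != 0 by apply: contraNneq cT => ->; exact: mem0v.
have [X AX Xc] := coneset_neq0 c0 Cc.
exists X => //; rewrite Xc; split; first by rewrite -memvE.
apply: pspace_memE => //.
by rewrite -(opprK c) -[- c](addKr v) addrC opprB memvB // ?(subvP TW).
Qed.

Lemma proj_image_spanP T A v (vT : v \notin T) :
  proj_image T A (PSpace (pspace_span vT)) <->
  exists2 c, coneset A c & v - c \in T.
Proof. by apply: proj_imageP; rewrite //= memvE addvSr. Qed.

Lemma hyperplane_normal H : \dim H = n ->
  exists2 h, h != 0 & forall v, (v \in H) = (dot v h == 0).
Proof.
move=> /hyp_surj[q <-]; have [h h0 qh] := RP_gen q; exists h => // v.
rewrite /hyp qh; apply/mem_perpP/eqP => [->|vh _ /vlineP[k ->]] //.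
  exact: memv_line.
by rewrite dotZr vh mulr0.
Qed.

Lemma mem_perp_line v h : (v \in perp <[h]>%VS) = (dot v h == 0).
Proof.
apply/mem_perpP/eqP => [->|vh _ /vlineP[k ->]] //; first exact: memv_line.
by rewrite dotZr vh mulr0.
Qed.

Lemma dim_perp_line h : h != 0 -> \dim (perp <[h]>%VS) = n.
Proof.
by move=> h0; have := dim_perp <[h]>%VS; rewrite dim_vline h0 => -[].
Qed.

(** * Hyperplanes of [L] orthogonal to a vector of [L] *)

Section CapLine.
Context (L : {vspace V}) (p : V) (pL : p \in L) (p0 : p != 0).
Local Notation T := (L :&: perp <[p]>)%VS.

Lemma mem_cap_perp_line v : (v \in T) = (v \in L) && (dot v p == 0).
Proof. by rewrite memv_cap mem_perp_line. Qed.

Lemma notin_cap_perp_line : p \notin T.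
Proof. by rewrite mem_cap_perp_line dot_eq0 (negPf p0) andbF. Qed.

Lemma cap_perp_line_add : (T + <[p]> = L)%VS.
Proof.
apply/eqP; rewrite eqEsubv subv_add capvSl -memvE pL /=.
apply/subvP => l lL; rewrite -(subrK ((dot l p / dot p p) *: p) l).
rewrite memv_add ?memvZ ?memv_line // mem_cap_perp_line memvB ?memvZ //=.
by rewrite dotDl dotNl dotZl divfK ?dot_eq0 // subrr.
Qed.

Lemma dim_cap_perp_line : \dim L = (\dim T).+1.
Proof.
by have /andP[_ /eqP] := pspace_span notin_cap_perp_line;
  rewrite cap_perp_line_add.
Qed.

End CapLine.
End Projective.

(** * From convex projective sections to convex fibres *)

Section ConeOfConvexConcave.
Context {R : realType} {n : nat}.
Local Notation V := 'rV[R]_n.+1.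
Implicit Types (c d v w x y p q h : V).
Context (L : {vspace V}) (A : set (RP R n)) (hA : convex_concave L A).
Local Notation C := (coneset A).

Lemma coneset_scale (a : R) v : C v -> C (a *: v).
Proof.
case=> [->|[W AW vW]]; first by rewrite scaler0; left.
by right; exists W; rewrite ?memvZ.
Qed.

Lemma coneset_disj v : C v -> v \in L -> v = 0.
Proof.
move=> Cv vL; apply/eqP/negPn/negP => v0; have [W AW Wv] := coneset_neq0 v0 Cv.
case: hA => _ disj _ _; have : (A `&` pts L) W.
  by split; rewrite // /pts /= Wv -memvE.
by rewrite disj.
Qed.

(** A point of the section by [L + <[x]>] has a nonzero component along [x], because [A] avoids [L],
    so it rescales into [x + L]. *)
Lemma coneset_inhab x : fiber L C x !=set0.
Proof.
case: (boolP (x \in L)) => xL.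
  by exists 0; split; [left | rewrite sub0r memvN].
have /andP[LN /eqP dN] := pspace_span xL.
case: hA => _ _ /(_ _ LN) sec _; have [|[W [AW WN]] _] := sec.
  by rewrite /pdim dN; lia.
have [w w0 Ww] := RP_gen W.
have Cw : C w by right; exists W; rewrite ?Ww ?memv_line.
move: WN; rewrite /pts /= Ww -memvE => /memv_addP[l lL [_ /vlineP[t ->] wE]].
have t0 : t != 0.
  apply: contraNneq w0 => t0; apply/eqP/coneset_disj => //.
  by rewrite wE t0 scale0r addr0.
exists (t^-1 *: w); split; first exact: coneset_scale.
by rewrite wE scalerDr scalerK // addrK memvZ.
Qed.

(** Convexity is given in a chart containing [c] and a multiple [a *: d]. A negative [a] would make
    their segment cross [L], which [A] avoids; for positive [a] the wanted point is a multiple of a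
    point of the segment. *)
Lemma coneset_conv (t : R) c d : C c -> C d -> c - d \in L -> 0 <= t <= 1 ->
  C (t *: c + (1 - t) *: d).
Proof.
move=> Cc Cd cdL t01.
case: (boolP (c \in L)) => cL.
  have c0 := coneset_disj Cc cL; move: cdL; rewrite c0 sub0r memvN => dL.
  by rewrite (coneset_disj Cd dL) !scaler0 addr0; left.
have dL : d \notin L by apply: contra cL => dL; rewrite -(subrK d c) memvD.
have c0 : c != 0 by apply: contraNneq cL => ->; exact: mem0v.
have d0 : d != 0 by apply: contraNneq dL => ->; exact: mem0v.
have /andP[LN /eqP dN] := pspace_span cL.
set N := (L + <[c]>)%VS in LN dN.
have cN : c \in N by rewrite memvE addvSr.
have dN' : d \in N.
  by rewrite -[d]opprK -[- d](addKr c) addrC opprB memvB // (subvP LN).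
case: hA => _ _ /(_ _ LN) sec _.
have [|_ [H [_ /hyperplane_normal[h h0 HE] HN Hcv]]] := sec.
  by rewrite /pdim dN; lia.
have notH v : v != 0 -> C v -> v \in N -> dot v h != 0.
  move=> v0 Cv vN; have [W AW Wv] := coneset_neq0 v0 Cv.
  have /HN : (A `&` pts N) W by split; rewrite // /pts /= Wv -memvE.
  by rewrite Wv -memvE HE.
have ch := notH _ c0 Cc cN; have dh := notH _ d0 Cd dN'.
have /convex_setP Hc : convex_set (affine_trace (A `&` pts N) H c).
  by apply: Hcv; rewrite HE.
pose a := dot c h / dot d h.
have a0 : a != 0 by rewrite mulf_neq0 // invr_eq0.
have trace v : v \in N -> v != 0 -> C v -> dot v h = dot c h ->
    affine_trace (A `&` pts N) H c v.
  move=> vN v0 Cv vh; have [W AW Wv] := coneset_neq0 v0 Cv.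
  split; first by rewrite HE dotDl dotNl vh subrr.
  by exists W; [split; rewrite // /pts /= Wv -memvE | rewrite Wv memv_line].
have Tc : affine_trace (A `&` pts N) H c c by exact: trace.
have Td : affine_trace (A `&` pts N) H c (a *: d).
  apply: trace;
    [exact: memvZ | | exact: coneset_scale | by rewrite dotZl divfK].
  by rewrite scaler_eq0 negb_or a0.
have seg (s : R) : 0 <= s <= 1 -> C (s *: c + (1 - s) *: (a *: d)).
  by move=> s01; have [_ [W [AW _] vW]] := Hc _ _ _ Tc Td s01; right; exists W.
have [an|ap] := ltP a 0.
  have b0 : 0 < 1 - a by lra.
  have s01 : 0 <= - a / (1 - a) <= 1.
    by rewrite divr_ge0 ?ler_pdivrMr ?mul1r //; lra.
  have := seg _ s01; set e := _ + _ => Ce.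
  have eL : e \in L.
    rewrite (_ : e = (- a / (1 - a)) *: (c - d)) ?memvZ //.
    by apply/rowP => i; rewrite !mxE; field; rewrite gt_eqF.
  have := coneset_disj Ce eL => e0.
  have : dot e h = dot c h.
    have cE : dot c h = a * dot d h by rewrite divfK.
    by rewrite /e !dotE cE; field; rewrite gt_eqF.
  by rewrite e0 dot0l => /esym/eqP; rewrite (negPf ch).
have {a0}ap : 0 < a by rewrite lt_def a0.
(* The sum of the coefficients of [t *: c + (1 - t) *: d] in terms of [c] and [a *: d]. *)
pose k := t + (1 - t) / a.
have [t0 t1] : 0 <= t /\ t <= 1 by apply/andP.
have ta : 0 <= (1 - t) / a by apply: divr_ge0; [lra | exact: ltW].
have k0 : 0 < k.
  rewrite /k; have [->|tn] := eqVneq t 0; first by rewrite add0r subr0 divr_gt0.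
  by apply: ltr_pwDl => //; rewrite lt_def tn.
have -> : t *: c + (1 - t) *: d = k *: ((t / k) *: c + (1 - t / k) *: (a *: d)).
  have <- : (k - t) * a = 1 - t by rewrite /k addrAC subrr add0r divfK ?gt_eqF.
  by apply/rowP => i; rewrite !mxE; field; rewrite gt_eqF.
apply/coneset_scale/seg/andP; split; first by apply: divr_ge0 => //; exact: ltW.
by rewrite ler_pdivrMr // mul1r /k; lra.
Qed.

Lemma section_convex_coneset : section_convex_cone L C.
Proof.
split.
- by case: hA => /closed_coneset.
- exact: coneset_scale.
- exact: coneset_disj.
- exact: coneset_inhab.
- exact: coneset_conv.
Qed.

End ConeOfConvexConcave.

(** * Convex complements of projections and subadditivity *)

Section ProjectionsOfConvexConcave.
Context {R : realType} {n : nat}.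
Local Notation V := 'rV[R]_n.+1.
Implicit Types (c d v w x y p q h : V).
Context (L : {vspace V}) (A : set (RP R n)) (hA : convex_concave L A).
Local Notation C := (coneset A).
Let hS := section_convex_coneset hA.

(** Project from [T], the hyperplane of [L] orthogonal to [p]. In a chart [w = 1], classes over
    whose sections [w] stays below 1 are in the complement. If [dot w c] exceeded the sum of the two
    maxima, a convex combination of such classes would be the class of a multiple of [c], which is
    in the projection. *)
Lemma coneset_sub_orthogonal p c x y : p \in L -> p != 0 ->
  fiber L C (x + y) c -> exists c1 c2, [/\ fiber L C x c1, fiber L C y c2 &
      dot p c <= dot p c1 + dot p c2].
Proof.
move=> pL p0 [Cc cxy]; set T := (L :&: perp <[p]>)%VS.
have pT : p \notin T by exact: notin_cap_perp_line.
have dT : \dim L = (\dim T).+1 by exact: dim_cap_perp_line.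
have TL : (T <= L)%VS by exact: capvSl.
have TE v : (v \in T) = (v \in L) && (dot v p == 0) by exact: mem_cap_perp_line.
case: hA => _ _ _ /(_ _ TL)[|_]; first by rewrite /pdim dT; lia.
set S := ~` proj_image T A.
case=> _ [H [TH /hyperplane_normal[h h0 HE] SH cvH]].
have pp : 0 < dot p p by rewrite dot_gt0.
(* [p] spans [L] modulo [T] and [A] avoids [L], so the class of [p] is in the complement, hence off
   [H]. *)
have ph : dot p h != 0.
  have SL : S (PSpace (pspace_span pT)).
    move=> /proj_image_spanP[c' Cc' c'T].
    have /(cc_disj hS Cc') c'0 : c' \in L.
      by rewrite -[c']opprK -[- c'](addKr p) addrC opprB memvB // (subvP TL).
    by move: c'T; rewrite c'0 subr0 (negPf pT).
  rewrite -HE; apply: contra (SH _ SL) => pH /=.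
  by rewrite subv_add TH -memvE.
(* The normal of [H], rescaled to agree with [p] on [L]. *)
pose w := (dot p p / dot p h) *: h.
have wH v : (v \in H) = (dot v w == 0).
  rewrite HE /w dotZr mulf_eq0 orbC; case: eqP => //= _.
  by rewrite mulf_eq0 invr_eq0 (negPf ph) orbF gt_eqF.
have wp : dot p w = dot p p by rewrite dotZr divfK.
have wL l : l \in L -> dot l w = dot l p.
  rewrite -(cap_perp_line_add pL p0) => /memv_addP[t tT [_ /vlineP[a ->] ->]].
  have := subvP TH _ tT; rewrite wH => /eqP tw.
  have := tT; rewrite TE => /andP[_ /eqP tp].
  by rewrite !dotDl tw tp !dotZl wp.
(* [H] lies inside the projection, so [w] vanishes somewhere on every section and its maxima are
   nonnegative. *)
have zero z : exists2 e, fiber L C z e & dot w e = 0.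
  case: (boolP (z \in L)) => zL.
    by exists 0; [split; [left | rewrite sub0r memvN] | rewrite dot0r].
  pose v := z - (dot z w / dot p p) *: p.
  have vw : dot v w = 0 by rewrite dotDl dotNl dotZl wp divfK ?gt_eqF // subrr.
  have zvL : z - v \in L by rewrite opprB addrC subrK memvZ.
  have vT : v \notin T.
    apply: contra zL => /(subvP TL) vL; by rewrite -(subrK v z) memvD.
  have : ~ S (PSpace (pspace_span vT)).
    by move=> /SH /=; rewrite subv_add TH -memvE wH vw eqxx.
  move=> /contrapT/proj_image_spanP[e Ce veT].
  have veL := subvP TL _ veT.
  exists e; last first.
    move: veT; rewrite TE veL -(wL _ veL) dotDl dotNl vw sub0r oppr_eq0 /=.
    by rewrite dotC => /eqP.
  split => //; have -> : e - z = - (z - v) - (v - e).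
    by apply/rowP => i; rewrite !mxE; ring.
  by rewrite memvB ?memvN.
have [c1 F1 max1] := fiber_max hS w x; have [c2 F2 max2] := fiber_max hS w y.
exists c1, c2; split => //.
have cL : c - c1 - c2 \in L.
  have -> : c - c1 - c2 = (c - (x + y)) - (c1 - x) - (c2 - y).
    by apply/rowP => i; rewrite !mxE; ring.
  by apply: memvB; [apply: memvB => //; case: F1 | case: F2].
suff : dot w c <= dot w c1 + dot w c2.
  move: (wL _ cL); rewrite ![dot w _]dotC ![dot p _]dotC !dotE; lra.
rewrite leNgt; apply/negP => lt.
have m1 : 0 <= dot w c1 by have [e Fe <-] := zero x; exact: max1.
have m2 : 0 <= dot w c2 by have [e Fe <-] := zero y; exact: max2.
(* With half the excess added to each maximum, the two levels are positive and add up to [s]. *)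
pose s := dot w c; pose dl := (s - dot w c1 - dot w c2) / 2.
have dl0 : 0 < dl by rewrite /dl /s; lra.
(* A level [a] above the maximum gives a class in the complement: a point of [C] in that class,
   scaled by [a], would reach height [a] over [z]. *)
have lift (z e : V) (a : R) : fiber L C z e ->
    (forall d, fiber L C z d -> dot w d <= dot w e) -> dot w e < a -> 0 < a ->
    exists v, [/\ dot v w = 1, v - a^-1 *: z \in L &
      affine_trace S H ((dot p p)^-1 *: p) v].
  move=> Fe maxe ea a0.
  pose v := a^-1 *: z + ((1 - dot z w / a) / dot p p) *: p.
  have vw : dot v w = 1.
    by rewrite dotDl !dotZl wp divfK ?gt_eqF // [a^-1 * _]mulrC addrC subrK.
  have vz : v - a^-1 *: z \in L by rewrite /v [a^-1 *: z + _]addrC addrK memvZ.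
  exists v; split => //; split.
    by rewrite wH dotDl dotNl dotZl wp vw mulVf ?subrr // dot_eq0.
  have vT : v \notin T.
    rewrite TE; apply/negP => /andP[vL]; rewrite -wL // vw oner_eq0 //.
  have vW : v \in (T + <[v]>)%VS by rewrite memvE addvSr.
  exists (PSpace (pspace_span vT)) => //.
  move=> /proj_image_spanP[e' Ce' veT].
  have veL := subvP TL _ veT.
  have we' : dot w e' = 1.
    move: veT; rewrite TE veL -(wL _ veL) dotDl dotNl vw subr_eq0 /=.
    by rewrite dotC => /eqP.
  have Fe' : fiber L C (a^-1 *: z) e'.
    split=> //.
    have -> : e' - a^-1 *: z = (v - a^-1 *: z) - (v - e').
      by apply/rowP => i; rewrite !mxE; ring.
    exact: memvB.
  have := fiberZ hS a Fe'; rewrite scalerA mulfV ?gt_eqF // scale1r => /maxe.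
  by rewrite dotZr we' mulr1 leNgt ea.
have [||v1 [v1w v1x tr1]] := lift x c1 (dot w c1 + dl) F1 max1 _ _; [lra|lra|].
have [||v2 [v2w v2y tr2]] := lift y c2 (dot w c2 + dl) F2 max2 _ _; [lra|lra|].
have s0 : 0 < s by rewrite /s; lra.
have sn0 : s != 0 by rewrite gt_eqF.
have /convex_setP cvS : convex_set (affine_trace S H ((dot p p)^-1 *: p)).
  by apply: cvH; rewrite wH dotZl wp mulVf ?oner_eq0 // dot_eq0.
pose t := (dot w c1 + dl) / s.
have tE : 1 - t = (dot w c2 + dl) / s.
  rewrite /t -[X in X - _](@divff _ s) // -mulrBl /dl.
  by congr (_ / _); field.
have [|_ [W WS vW]] := cvS t v1 v2 tr1 tr2.
  by apply/andP; split; rewrite -?[t <= 1]subr_ge0 ?tE; apply: divr_ge0; lra.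
set v := t *: v1 + (1 - t) *: v2 in vW.
have vw : dot v w = 1 by rewrite dotDl !dotZl v1w v2w; ring.
have vcL : v - s^-1 *: c \in L.
  have -> : v - s^-1 *: c = t *: (v1 - (dot w c1 + dl)^-1 *: x) +
      (1 - t) *: (v2 - (dot w c2 + dl)^-1 *: y) - s^-1 *: (c - (x + y)).
    rewrite tE /v tE /t.
    by apply/rowP => i; rewrite !mxE; field; rewrite !gt_eqF //; lra.
  by rewrite memvB ?memvD ?memvZ.
apply: WS; apply/(proj_imageP A _ vW).
  by rewrite TE; apply/negP => /andP[vL]; rewrite -wL // vw oner_eq0.
exists (s^-1 *: c); first exact: coneset_scale.
by rewrite TE vcL -wL // dotDl dotNl dotZl vw [dot c w]dotC mulVf // subrr /=.
Qed.

(** The component of [q] in [perp L] is constant on each section and additive in [x]; the component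
    in [L] is the case of [coneset_sub_orthogonal]. *)
Lemma ccone_coneset : ccone L C.
Proof.
split=> // q c x y Fc.
have [p [k [pL kK ->]]] := perp_split L q.
have [c1 [c2 [F1 F2 le12]]] : exists c1 c2, [/\ fiber L C x c1, fiber L C y c2 &
    dot p c <= dot p c1 + dot p c2].
  have [->|p0] := eqVneq p 0; last exact: coneset_sub_orthogonal.
  have [c1 F1] := cc_inhab hS x; have [c2 F2] := cc_inhab hS y.
  by exists c1, c2; split; rewrite // !dot0l addr0.
exists c1, c2; split; rewrite // !dotDl (dot_fiber kK Fc) (dot_fiber kK F1).
by rewrite (dot_fiber kK F2) dotDr; lra.
Qed.

End ProjectionsOfConvexConcave.

(** * From cones back to projective sets *)

Section ConvexConcaveOfCone.
Context {R : realType} {n : nat}.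
Local Notation V := 'rV[R]_n.+1.
Implicit Types (c d v w x y p q h : V) (T N : {vspace V}).
Context (L : {vspace V}) (A : set (RP R n)).
Local Notation C := (coneset A).
Context (hC : ccone L C).

(** The hyperplane orthogonal to [k] meets [N] in [L], which [A] avoids; in its chart, points of [N]
    differ by vectors of [L], so [cc_conv] applies. *)
Lemma convex_section N : (L <= N)%VS -> \dim N = (\dim L).+1 ->
  projectively_convex (A `&` pts N).
Proof.
move=> LN dN.
have LNP : (L <= N)%VS && (\dim N == (\dim L).+1) by rewrite LN dN eqxx.
have [x /= xN xL] := pspace_notsub (PSpace LNP).
have [l [k [lL kK xE]]] := perp_split L x.
have kL : k \notin L by apply: contra xL => kL; rewrite xE memvD.
have k0 : k != 0 by apply: contraNneq kL => ->; exact: mem0v.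
have NE : (L + <[k]>)%VS = N.
  apply: (pspace_memE (W := PSpace LNP)) => //=.
  by rewrite -(addKr l k) -xE memvD // memvN (subvP LN).
have NL v : v \in N -> dot v k = 0 -> v \in L.
  rewrite -NE => /memv_addP[u uL [_ /vlineP[t ->] ->]] /eqP.
  rewrite dotDl dotZl (dot_perp uL kK) add0r mulf_eq0 dot_eq0 (negPf k0) orbF.
  by move=> /eqP ->; rewrite scale0r addr0.
have sectP v : v != 0 -> C v -> v \in N ->
    exists2 W : RP R n, (A `&` pts N) W & v \in pspace_val W.
  move=> v0 Cv vN; have [W AW Wv] := coneset_neq0 v0 Cv.
  by exists W; [split; rewrite // /pts /= Wv -memvE | rewrite Wv memv_line].
have sectE v : (exists2 W : RP R n, (A `&` pts N) W & v \in pspace_val W) ->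
    C v /\ v \in N.
  by case=> W [AW WN] vW; split; [right; exists W | exact: (subvP WN)].
split.
  have [c [Cc cx]] := cc_inhab hC x.
  have [||W hW _] := sectP c _ Cc.
  - apply: contraNneq xL => c0; move: cx; rewrite c0 sub0r.
    by rewrite memvN.
  - by rewrite -(subrK x c) memvD // (subvP LN).
  - by exists W.
exists (perp <[k]>%VS); split.
- exact: sub0v.
- exact: dim_perp_line.
- move=> W hW; have [c c0 Wc] := RP_gen W.
  have [Cc cN] : C c /\ c \in N.
    by apply: sectE; exists W; rewrite ?Wc ?memv_line.
  apply/negP; rewrite Wc -memvE mem_perp_line => /eqP /(NL _ cN) cL.
  by move: c0; rewrite (cc_disj hC Cc cL) eqxx.
move=> u; rewrite mem_perp_line => uk; apply/convex_setP => t v1 v2.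
move=> [+ /sectE[C1 N1]] [+ /sectE[C2 N2]] t01.
rewrite !mem_perp_line !dotDl !dotNl !subr_eq0 => /eqP k1 /eqP k2.
have vk : dot (t *: v1 + (1 - t) *: v2) k = dot u k.
  by rewrite dotDl !dotZl k1 k2; ring.
split; first by rewrite mem_perp_line dotDl dotNl vk subrr.
apply: sectP.
- by apply: contraNneq uk => v0; rewrite -vk v0 dot0l.
- apply: (cc_conv hC C1 C2 _ t01); apply: NL; first exact: memvB.
  by rewrite dotDl dotNl k1 k2 subrr.
- by rewrite memvD ?memvZ.
Qed.

(** Points of [C] congruent modulo [T] to a vector near [v] are bounded by [cone_bound], so the tube
    lemma applies to a compact truncation of [C]. *)
Lemma proj_image_span_open T : (T <= L)%VS -> open (~` proj_image T A).
Proof.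
move=> TL.
suff : open [set v | forall c, C c -> v - c \notin T].
  rewrite (_ : [set v | _] = cone (~` proj_image T A)) //.
  apply/seteqP; split => v.
    move=> /= hv; have vT : v \notin T.
      by have := hv 0; rewrite subr0; apply; left.
    split => //; exists (PSpace (pspace_span vT)); last first.
      by rewrite /= memvE addvSr.
    by move=> /proj_image_spanP[c Cc]; apply/negP; exact: hv.
  move=> [vT [W SW vW]] c Cc; apply/negP => vcT; apply: SW.
  by apply/(proj_imageP A vT vW); exists c.
have [M M0 hM] := cone_bound hC.
rewrite openE => v hv.
pose K := C `&` [set c : V | `|c| <= M * (`|v| + 1)].
have cK : compact K.
  apply: bounded_closed_compact.
    exists (M * (`|v| + 1)); split; first by rewrite num_real.
    by move=> r rM c [_ /= cM]; apply: (le_trans cM); exact: ltW.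
  apply: closedI; first exact: cc_closed hC.
  apply: (@preimage_closed _ _ (fun v : V => `|v|)
            [set r : R | r <= M * (`|v| + 1)]).
    by move=> u _; exact: norm_continuous.
  exact: closed_le.
pose O := [set p : V * V | p.1 - p.2 \notin T].
have oO : open O.
  rewrite (_ : O = (fun p : V * V => p.1 - p.2) @^-1` (~` [set v | v \in T])).
    apply: open_comp; last by apply: closed_openC; exact: closed_vspace.
    move=> p _; apply: (@continuousB _ V).
      exact: cvg_fst.
    exact: cvg_snd.
  by apply/seteqP; split => p /= /negP.
have KO c : K c -> O (v, c) by move=> [Cc _]; exact: hv.
have nearv : \forall u \near v, `|u| < `|v| + 1.
  have : open [set u : V | `|u| < `|v| + 1].
    apply: (@open_comp _ _ (fun u : V => `|u|) [set r : R | r < `|v| + 1]).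
      by move=> u _; exact: norm_continuous.
    exact: open_lt.
  by rewrite openE; apply; rewrite /= ltrDl.
near=> u.
have uK : K `<=` [set c | O (u, c)].
  by near: u; exact: compact_tube cK oO KO.
move=> c Cc; apply/negP => ucT.
have ucL : c - u \in L by rewrite -memvN opprB (subvP TL).
have Kc : K c.
  split => //=; apply: le_trans (hM _ _ Cc ucL) _; rewrite ler_pM2l //.
  apply: ltW.
  by near: u.
by have := uK c Kc; rewrite /O /= ucT.
Unshelve. all: by end_near. Qed.

(** The hyperplane removed is orthogonal to a dual element [b] over [p]: it meets every section, so
    it lies in the projection. In its chart the complement is given by a strict bound on a support
    function, and subadditivity makes it convex. *)
Lemma convex_proj_complement T : (T <= L)%VS -> \dim L = (\dim T).+1 ->
  projectively_convex (~` proj_image T A).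
Proof.
move=> TL dL.
have TLP : (T <= L)%VS && (\dim L == (\dim T).+1) by rewrite TL dL eqxx.
have [x /= xL xT] := pspace_notsub (PSpace TLP).
have [r [p [rT pT' xE]]] := perp_split T x.
have pL : p \in L by rewrite -(addKr r p) -xE memvD // memvN (subvP TL).
have p0 : p != 0 by apply: contraNneq xT => p0; rewrite xE p0 addr0.
have TE v : (v \in T) = (v \in L) && (dot v p == 0).
  suff -> : T = (L :&: perp <[p]>)%VS by exact: mem_cap_perp_line.
  apply/eqP; rewrite eqEdim; apply/andP; split.
    apply/subvP => z zT; rewrite memv_cap mem_perp_line (dot_perp zT pT') eqxx.
    by rewrite (subvP TL).
  by have := dim_cap_perp_line pL p0; rewrite dL => -[->].
have pT : p \notin T by rewrite TE dot_eq0 (negPf p0) andbF.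
have [b [Bb bp]] := cc_inhab (ccone_dual_cone hC) p.
have bL l : l \in L -> dot l b = dot l p.
  move=> lL; apply/eqP; rewrite -subr_eq0 -dotNr -dotDr.
  by rewrite (dot_perp lL bp).
have b0 : b != 0.
  by rewrite -dot_eq0; apply: contraNneq p0 => b0; rewrite -dot_eq0 -bL // ;
     move/eqP: b0; rewrite dot_eq0 => /eqP ->; rewrite dot0r.
have inproj (W : pspace T) v c : v \notin T -> v \in pspace_val W ->
    fiber L C v c -> dot v b = dot c b -> proj_image T A W.
  move=> vT vW [Cc cv] vc; apply/(proj_imageP A vT vW); exists c => //.
  have vcL : v - c \in L by rewrite -memvN opprB.
  by rewrite TE vcL -bL // dotDl dotNl vc subrr eqxx.
split.
  exists (PSpace (pspace_span pT)) => /proj_image_spanP[c Cc pcT].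
  have cL : c \in L.
    by rewrite -[c]opprK -[- c](addKr p) addrC opprB memvB // (subvP TL).
  by move: pcT; rewrite (cc_disj hC Cc cL) subr0 (negPf pT).
have notT v : dot v b != 0 -> v \notin T.
  by apply: contra; rewrite TE => /andP[vL]; rewrite bL.
exists (perp <[b]>%VS); split.
- by apply/subvP => v; rewrite TE mem_perp_line => /andP[vL]; rewrite bL.
- exact: dim_perp_line.
- move=> W SW; apply/negP => WH; have [v vW vT] := pspace_notsub W.
  apply: SW; have [c Fc bc] := Bb v; apply: (inproj W v c) => //.
  by have := subvP WH _ vW; rewrite mem_perp_line => /eqP ->; rewrite dotC bc.
move=> u; rewrite mem_perp_line => ub; apply/convex_setP => t v1 v2.
set s := dot u b in ub.
move=> [+ [W1 S1 vW1]] [+ [W2 S2 vW2]] /andP[t0 t1].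
rewrite !mem_perp_line !dotDl !dotNl -/s !subr_eq0 => /eqP b1 /eqP b2.
set v := t *: v1 + (1 - t) *: v2.
have vb : dot v b = s by rewrite dotDl !dotZl b1 b2; ring.
have vT : v \notin T by apply: notT; rewrite vb.
split; first by rewrite mem_perp_line dotDl dotNl vb subrr.
exists (PSpace (pspace_span vT)); last by rewrite /= memvE addvSr.
move=> /proj_image_spanP[c Cc vcT].
have Fc : fiber L C v c by split; rewrite // -memvN opprB (subvP TL).
have cb : dot b c = s.
  move: vcT; rewrite TE => /andP[vcL]; rewrite -bL // dotDl dotNl vb subr_eq0.
  by rewrite dotC => /eqP.
have s2 : 0 < s * s by rewrite lt_def mulf_neq0 //= -expr2 sqr_ge0.
(* Otherwise the form, which has a zero on the section, would take the value [s * s] there, placing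
   [z] in the projection. The factor [s] in [s *: b] covers both signs of [s]. *)
have below (W : pspace T) z e : ~ proj_image T A W ->
    z \in pspace_val W -> dot z b = s -> fiber L C z e ->
    dot (s *: b) e < s * s.
  move=> SW zW zb Fe; rewrite ltNge; apply/negP => le.
  apply: SW; have [e0 F0 be0] := Bb z.
  have [|e1 F1] := fiber_ivt hC F0 Fe (a := s * s) (q := s *: b).
    by rewrite dotZl be0 mulr0 ltW.
  rewrite dotZl => /(mulfI ub) be1.
  by apply: (inproj W z e1) => //; [apply: notT; rewrite zb | rewrite zb dotC].
have scaled (W : pspace T) (a : R) z e : ~ proj_image T A W ->
    z \in pspace_val W -> dot z b = s -> fiber L C (a *: z) e -> 0 < a ->
    dot (s *: b) e < a * (s * s).
  move=> SW zW zb Fe a0; have := fiberZ hC a^-1 Fe.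
  rewrite scalerK ?gt_eqF // => /(below W z _ SW zW zb).
  by rewrite dotZr ltr_pdivrMl.
have zeroF z e : fiber L C (0 *: z) e -> e = 0.
  by rewrite scale0r => -[Ce]; rewrite subr0; exact: (cc_disj hC).
have [c1 [c2 [F1 F2]]] := cc_sub hC (s *: b) Fc.
rewrite dotZl cb.
(* At the end points one fibre lies over 0, outside the scope of [scaled], and reduces to the
   origin. *)
have [t00|tn0] := eqVneq t 0.
  move: F1 F2; rewrite t00 subr0 => /zeroF ->.
  move=> /(scaled W2 _ _ _ S2 vW2 b2) /(_ ltr01).
  by rewrite dot0r; lra.
have [t11|tn1] := eqVneq t 1.
  move: F1 F2; rewrite t11 subrr.
  move=> /(scaled W1 _ _ _ S1 vW1 b1) /(_ ltr01) + /zeroF ->.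
  by rewrite dot0r; lra.
have := scaled W1 _ _ _ S1 vW1 b1 F1; have := scaled W2 _ _ _ S2 vW2 b2 F2.
have tp : 0 < t by rewrite lt_def tn0.
have tp' : 0 < 1 - t by rewrite subr_gt0 lt_def eq_sym tn1.
by move=> /(_ tp') + /(_ tp); nra.
Qed.

Lemma convex_concave_of_cone : convex_concave L A.
Proof.
split.
- exact/closed_coneset/(cc_closed hC).
- apply/seteqP; split => // W [AW WL]; have [v v0 Wv] := RP_gen W.
  have vW : v \in pspace_val W by rewrite Wv memv_line.
  move/eqP: v0; apply; apply: (cc_disj hC); first by right; exists W.
  exact: (subvP WL).
- move=> N LN; rewrite /pdim => dN; apply: convex_section => //; lia.
move=> T TL; rewrite /pdim => dT; split; first exact: proj_image_span_open.
by apply: convex_proj_complement => //; lia.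
Qed.

(** Modulo [L :&: hyp Q], points of a section are distinguished only by the value of [q], so
    containment of the projections means a zero of [q] on every section. *)
Lemma coneset_Ldual : coneset (Ldual L A) = dual_cone L C.
Proof.
have hB := ccone_dual_cone hC.
have inhyp (Q : RP R n) q v : pspace_val Q = <[q]>%VS ->
    (v \in hyp Q) = (dot v q == 0).
  by move=> Qq; rewrite /hyp Qq mem_perp_line.
apply/seteqP; split => q.
  have [-> _|q0] := eqVneq q 0.
    by move=> x; have [c Fc] := cc_inhab hC x; exists c; rewrite ?dot0l.
  move=> /(coneset_neq0 q0)[Q [LQ projQ] Qq] x.
  have [p pL qp] : exists2 p, p \in L & dot p q != 0.
    by apply: notin_perp; apply: contra LQ; rewrite /hyp sub_perpC Qq -memvE.
  case: (boolP (x \in L)) => xL.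
    by exists 0; rewrite ?dot0r //; split; [left | rewrite sub0r memvN].
  set T := (L :&: hyp Q)%VS in projQ *.
  pose v := x - (dot x q / dot p q) *: p.
  have vq : dot v q = 0 by rewrite dotDl dotNl dotZl divfK // subrr.
  have vT : v \notin T.
    rewrite memv_cap negb_and; apply/orP; left; apply: contra xL => vL.
    by rewrite -(subrK ((dot x q / dot p q) *: p) x) memvD ?memvZ.
  have [|c Cc] := iffLR (proj_image_spanP A vT) (projQ _ _).
    apply/proj_image_spanP; exists v; last by rewrite subrr mem0v.
    by apply/coneset_pts; rewrite (inhyp _ _ _ Qq) vq.
  rewrite memv_cap (inhyp _ _ _ Qq) dotDl dotNl vq sub0r oppr_eq0.
  move=> /andP[vcL /eqP cq].
  exists c; last by rewrite dotC.
  split=> //; have -> : c - x = - (v - c) - (dot x q / dot p q) *: p.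
    by apply/rowP => i; rewrite !mxE; ring.
  by rewrite memvB ?memvN ?memvZ.
move=> Bq; have [->|q0] := eqVneq q 0; first by left.
have [Q Qq] := vline_point q0.
apply/(coneset_mem _ q0 (W := Q)); first by rewrite Qq memv_line.
split.
  apply: contra q0 => LQ; apply/eqP/(cc_disj hB Bq).
  by move: LQ; rewrite /hyp sub_perpC Qq -memvE.
move=> W; have [v vW vT] := pspace_notsub W.
move=> /(proj_imageP _ vT vW)[d /coneset_pts dQ vdT].
apply/(proj_imageP _ vT vW).
have vQ : v \in hyp Q.
  by rewrite -(subrK d v) memvD //; move: vdT; rewrite memv_cap => /andP[].
have [c [Cc cv] qc] := Bq v; exists c => //.
rewrite memv_cap -memvN opprB cv; apply: memvB => //.
by rewrite (inhyp _ _ _ Qq) dotC qc.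
Qed.

(** [M] misses [L] and so complements it by dimension; every section then contains a point of [M],
    where forms in [perp M] vanish. *)
Lemma perp_subspace_dual (M : {vspace V}) : pts M `<=` A ->
  (\dim M + \dim L = n.+1)%N -> pts (perp M) `<=` Ldual L A.
Proof.
move=> MA dML Q QM; have [q q0 Qq] := RP_gen Q.
have qQ : q \in pspace_val Q by rewrite Qq memv_line.
apply/(coneset_mem _ q0 qQ); rewrite coneset_Ldual => x.
have MC m : m \in M -> C m.
  have [->|m0] := eqVneq m 0; first by left.
  move=> mM; have [W Wm] := vline_point m0; right; exists W.
    by apply: MA; rewrite /pts /= Wm -memvE.
  by rewrite Wm memv_line.
have ML0 : (M :&: L = 0)%VS.
  apply/eqP; rewrite -subv0; apply/subvP => m; rewrite memv_cap memv0.
  by case/andP => mM mL; apply/eqP/(cc_disj hC) => //; exact: MC.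
have : x \in (M + L)%VS.
  suff -> : (M + L)%VS = fullv by rewrite memvf.
  apply/eqP; rewrite eqEdim subvf /= dimv_disjoint_sum // dML.
  by rewrite dimvf /dim /= mul1n.
move=> /memv_addP[m mM [l lL ->]]; exists m.
  by split; [exact: MC | rewrite opprD addrA subrr sub0r memvN].
by rewrite dotC; apply: dot_perp mM _; exact: (subvP QM).
Qed.

End ConvexConcaveOfCone.

(** * Duality of projective convex-concave sets *)

Theorem mainTheorem1 (R : realType) (n : nat) (L : {vspace 'rV[R]_n.+1})
    (A : set (RP R n)) :
  0 <= pdim L <= n%:Z - 1 ->
  convex_concave L A ->
  [/\ convex_concave (perp L) (Ldual L A),
      Ldual (perp L) (Ldual L A) = A,
      (exists2 M : {vspace 'rV[R]_n.+1},
         pdim M = n%:Z - 1 - pdim L & pts M `<=` A) <->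
      (exists2 M' : {vspace 'rV[R]_n.+1},
         pdim M' = n%:Z - 1 - pdim (perp L) & pts M' `<=` Ldual L A) &
      forall M' : {vspace 'rV[R]_n.+1},
        pts M' `<=` Ldual L A ->
        pdim M' + pdim (perp L) = n%:Z - 1 ->
        pts (perp M') `<=` A /\ pdim (perp M') + pdim L = n%:Z - 1].
Proof.
move=> dL hA; have hC := ccone_coneset hA.
have hB := ccone_dual_cone hC; rewrite -(coneset_Ldual hC) in hB.
have hAB : Ldual (perp L) (Ldual L A) = A.
  apply: coneset_inj.
  by rewrite (coneset_Ldual hB) (coneset_Ldual hC) dual_coneK.
have dK := dim_perp L.
(* The inclusion of subspaces is applied to the dual set, whose dual is [A] by [hAB]. *)
have back M : pts M `<=` Ldual L A -> pdim M + pdim (perp L) = n%:Z - 1 ->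
    pts (perp M) `<=` A /\ pdim (perp M) + pdim L = n%:Z - 1.
  move=> MB; rewrite /pdim => dM; have dM' := dim_perp M; split; last by lia.
  by rewrite -hAB; apply: (perp_subspace_dual hB MB); lia.
split => //; first exact: (convex_concave_of_cone hB).
split=> -[M dM MA]; exists (perp M).
- by have := dim_perp M; move: dM; rewrite /pdim; lia.
- by apply: (perp_subspace_dual hC MA); move: dM; rewrite /pdim; lia.
- by have := dim_perp M; move: dM; rewrite /pdim; lia.
- by have [|//] := back M MA; move: dM; rewrite /pdim; lia.
Qed.
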